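(* Let $K\subset\mathbb{R}^m$ be a self-dual cone and let $\sqcap,\sqcup$ be the generalized lattice operations defined by $K$. Let $C\subset\mathbb{R}^m$ be a nonempty closed convex set. If $C$ is invariant with respect to $\sqcap$ and $\sqcup$, then $C$ is an isotone projection set, i.e. for all $x,y\in\mathbb{R}^m$, $x\le_K y$ implies $P_Cx\le_K P_Cy$.
   Context: $\mathbb{R}^m$ carries the standard scalar product $\langle\cdot,\cdot\rangle$. A convex cone is a nonempty set $K$ with $K+K\subset K$ and $tK\subset K$ for all $t\ge 0$; it is self-dual if $K=K^*:=\{y\in\mathbb{R}^m:\langle x,y\rangle\ge 0\ \forall x\in K\}$. The order induced by $K$ is $x\le_K y\Leftrightarrow y-x\in K$. For a nonempty closed convex set $D$, $P_D x$ denotes the unique nearest point of $D$ to $x$. Generalized lattice operations: $x\sqcap y=P_{x-K}\,y$ and $x\sqcup y=P_{x+K}\,y$ for $x,y\in\mathbb{R}^m$. A set $M\subset\mathbb{R}^m$ is invariant with respect to $\sqcap$ and $\sqcup$ if $x,y\in M$ implies $x\sqcap y\in M$ and $x\sqcup y\in M$. *)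

(* Defs.v *)
From mathcomp Require Import all_boot all_order all_algebra.
From mathcomp Require Import all_classical all_reals all_analysis.

Set Implicit Arguments.
Unset Strict Implicit.
Unset Printing Implicit Defensive.

Import Order.TTheory GRing.Theory Num.Theory.
Import numFieldNormedType.Exports.

Local Open Scope classical_set_scope.
Local Open Scope ring_scope.

Section GeneralizedLattice.
Context {R : realType} {m : nat}.
Implicit Types (x y p t : 'rV[R]_m) (K C D M : set 'rV[R]_m).

Definition dotprod x y : R := \sum_(i < m) x 0 i * y 0 i.

(* The library's norm on 'rV[R]_m is the maximum norm, hence this definition;
   the induced topologies coincide. *)
Definition enorm x : R := Num.sqrt (dotprod x x).

Definition convex_cone K : Prop :=
  [/\ K !=set0,
      forall x y, K x -> K y -> K (x + y) &
      forall (t : R) x, 0 <= t -> K x -> K (t *: x)].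

Definition dual_cone K : set 'rV[R]_m :=
  [set y | forall x, K x -> 0 <= dotprod x y].

Definition self_dual_cone K : Prop := convex_cone K /\ K = dual_cone K.

Definition cone_le K x y : Prop := K (y - x).

Definition nearest_point D x p : Prop :=
  D p /\ forall q, D q -> enorm (x - p) <= enorm (x - q).

(* The nearest point is unique when D is nonempty, closed and convex; where
   there is none, the value is 0. *)
Definition proj D x : 'rV[R]_m := xget 0 [set p | nearest_point D x p].

Definition gmeet K x y : 'rV[R]_m := proj [set x - k | k in K] y.

Definition gjoin K x y : 'rV[R]_m := proj [set x + k | k in K] y.

Definition lattice_invariant K M : Prop :=
  forall x y, M x -> M y -> M (gmeet K x y) /\ M (gjoin K x y).

Definition isotone_projection_set K C : Prop :=
  forall x y, cone_le K x y -> cone_le K (proj C x) (proj C y).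

End GeneralizedLattice.

(* Main.v *)
(* Let u = P_C x and v = P_C y with x <=_K y, and let u - v = p - n be the Moreau
   decomposition: p, n in K and <p, n> = 0.  Then the meet of u and v is u - p
   and their join is v + p, so both points lie in C.  The obtuse-angle
   characterisation of the projection, tested at these points, gives
   <x - u, p> >= 0 and <y - v, p> <= 0.  Subtracting, and using <y - x, p> >= 0
   by self-duality, yields <p, p> = <u - v, p> <= 0, hence p = 0 and
   v - u = n in K. *)

Require Import Defs.
From mathcomp Require Import all_boot all_order all_algebra.
From mathcomp Require Import all_classical all_reals all_analysis.
From mathcomp Require Import ring lra.

Import Order.TTheory GRing.Theory Num.Theory.
Import numFieldNormedType.Exports.

Local Open Scope classical_set_scope.
Local Open Scope ring_scope.

Section NearestPoints.
Set Implicit Arguments.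
Unset Strict Implicit.

Context {R : realType} {m : nat}.
Implicit Types (x y z p q n u : 'rV[R]_m) (D K : set 'rV[R]_m).

Lemma dotprodC x y : dotprod x y = dotprod y x.
Proof. by apply: eq_bigr => i _; rewrite mulrC. Qed.

Lemma dotprodDl x y z : dotprod (x + y) z = dotprod x z + dotprod y z.
Proof. by rewrite -big_split; apply: eq_bigr => i _; rewrite mxE mulrDl. Qed.

Lemma dotprodZl (a : R) x y : dotprod (a *: x) y = a * dotprod x y.
Proof.
by rewrite /dotprod big_distrr; apply: eq_bigr => i _; rewrite mxE -mulrA.
Qed.

Lemma dotprodNl x y : dotprod (- x) y = - dotprod x y.
Proof. by rewrite -scaleN1r dotprodZl mulN1r. Qed.

Lemma dotprodDr x y z : dotprod x (y + z) = dotprod x y + dotprod x z.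
Proof. by rewrite !(dotprodC x) dotprodDl. Qed.

Lemma dotprodZr (a : R) x y : dotprod x (a *: y) = a * dotprod x y.
Proof. by rewrite !(dotprodC x) dotprodZl. Qed.

Lemma dotprodNr x y : dotprod x (- y) = - dotprod x y.
Proof. by rewrite !(dotprodC x) dotprodNl. Qed.

Definition dotprodE :=
  (dotprodDl, dotprodDr, dotprodNl, dotprodNr, dotprodZl, dotprodZr).

Lemma dotprod_ge0 x : 0 <= dotprod x x.
Proof. by apply: sumr_ge0 => i _; rewrite -expr2 sqr_ge0. Qed.

Lemma sqr_coord_le_dotprod x i : x 0 i ^+ 2 <= dotprod x x.
Proof.
rewrite /dotprod (bigD1 i)//= -expr2 lerDl.
by apply: sumr_ge0 => j _; rewrite -expr2 sqr_ge0.
Qed.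

Lemma dotprod_eq0 x : dotprod x x <= 0 -> x = 0.
Proof.
move=> x0; apply/rowP => i; rewrite mxE; apply/eqP.
by rewrite -sqrf_eq0 eq_le sqr_ge0 (le_trans (sqr_coord_le_dotprod x i) x0).
Qed.

Lemma enorm_le x y : (enorm x <= enorm y) = (dotprod x x <= dotprod y y).
Proof. exact: ler_sqrt (dotprod_ge0 y). Qed.

Lemma continuous_dotprod (f g : 'rV[R]_m -> 'rV[R]_m) :
  continuous f -> continuous g -> continuous (fun x => dotprod (f x) (g x)).
Proof.
move=> cf cg; apply: continuous_big => [|i _ x]; first exact: add_continuous.
have cont_coord (h : 'rV[R]_m -> 'rV[R]_m) :
    continuous h -> continuous (fun z => h z 0 i).
  move=> ch z.
  exact: (@continuous_comp _ _ _ h (fun M : 'rV[R]_m => M 0 i) z (ch z)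
    (@coord_continuous _ _ _ _ _ _)).
by apply: continuousM; exact: cont_coord.
Qed.

(** Links the two norms: a set bounded in the Euclidean sense is bounded for the maximum norm, which
    is the one the compactness argument needs. Coordinatewise it follows from [(|a| - 1)^2 >= 0]. *)
Lemma norm_le_dotprod x : `|x| <= 1 + dotprod x x.
Proof.
rewrite [leLHS]mx_normrE; apply/bigmax_leP; split => [|[i j] _] /=.
  by rewrite addr_ge0// dotprod_ge0.
rewrite (ord1 i); have := sqr_coord_le_dotprod x j.
by rewrite -real_normK ?num_real//; have := sqr_ge0 (`|x 0 j| - 1); nra.
Qed.

(** The squared distance [f] attains its minimum on the compact set [A] of points of [D] no farther
    from [x] than [q0]; the rest of [D] is farther away than [q0]. *)
Lemma nearest_point_exists D x :
  D !=set0 -> closed D -> exists p, nearest_point D x p.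
Proof.
move=> [q0 Dq0] clD.
pose f q := dotprod (x - q) (x - q).
have cf : continuous f.
  have cB : continuous (fun q : 'rV[R]_m => x - q).
    by move=> q; apply: continuousB; [exact: cst_continuous | exact: cvg_id].
  exact: (continuous_dotprod cB cB).
pose A := D `&` [set q | f q <= f q0].
have Aq0 : A q0 by split => //=.
have cA : compact A.
  apply: bounded_closed_compact.
    exists (`|x| + (1 + f q0)); split; first exact: num_real.
    move=> M ltM q [_ /= fq]; apply: le_trans (ltW ltM).
    rewrite -[q](subKr x) (le_trans (ler_normB _ _))// lerD2l.
    by rewrite (le_trans (norm_le_dotprod _))// lerD2l.
  apply: closedI => //.
  by apply: (@preimage_closed _ _ f [set r | r <= f q0]) => // q _; exact: cf.
have [|p /set_mem[Dp fp] minp] := compact_EVT_min _ cA (continuous_subspaceT cf).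
  by exists q0.
exists p; split => // q Dq; rewrite enorm_le -/(f p) -/(f q).
have [fq|/ltW fq] := leP (f q) (f q0); last exact: le_trans fp fq.
by apply: minp; apply/mem_set.
Qed.

Lemma proj_nearest D x : D !=set0 -> closed D -> nearest_point D x (Defs.proj D x).
Proof.
move=> D0 clD.
exact: (@xgetPex _ 0 [set p | nearest_point D x p] (nearest_point_exists x D0 clD)).
Qed.

Lemma nearest_point_obtuse D x p q :
  convex_set (D : set (convex_lmodType 'rV[R]_m)) ->
  nearest_point D x p -> D q -> dotprod (x - p) (q - p) <= 0.
Proof.
move=> cD [Dp minp] Dq; rewrite leNgt; apply/negP => a_gt0.
set a := dotprod _ _ in a_gt0.
pose b := dotprod (q - p) (q - p).
have b_ge0 : 0 <= b by exact: dotprod_ge0.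
(* With [a + b] as denominator, [a / (a + b)] lies in [(0, 1]] and its product with [b] is at most
   [a], whichever of [a] and [b] is larger. *)
have ab_gt0 : 0 < a + b by rewrite ltr_wpDr.
(* A step of length t from p towards q shrinks the squared distance to x
   as soon as t b < 2 a. *)
pose t := a / (a + b).
have t_gt0 : 0 < t by rewrite divr_gt0.
have t_le1 : t <= 1 by rewrite ler_pdivrMr// mul1r lerDl.
have tb : t * b <= a.
  by rewrite mulrAC ler_pdivrMr// ler_pM2l// lerDr ltW.
have /set_mem Dt := cD q p (Itv01 (ltW t_gt0) t_le1) (mem_set Dq) (mem_set Dp).
have := minp _ Dt; rewrite enorm_le.
have -> : x - conv (Itv01 (ltW t_gt0) t_le1)
    (q : convex_lmodType 'rV[R]_m) (p : convex_lmodType 'rV[R]_m)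
  = (x - p) - t *: (q - p).
  by apply/rowP => i; rewrite !mxE/= /unstable.onem; ring.
rewrite [leRHS](_ : _ = dotprod (x - p) (x - p) - t * (2 * a - t * b)).
  by rewrite lerDl oppr_ge0 leNgt mulr_gt0// subr_gt0; lra.
rewrite /a /b; move: (x - p) (q - p) => e d.
by rewrite !dotprodE (dotprodC d e); ring.
Qed.

(** Under the angle condition the expansion [pyth] gives [|x - q|^2 >= |x - p|^2 + |q - p|^2] on
    [D]. So [p] is nearest, and any nearest point, in particular the one picked by [xget], is at
    distance 0 from [p]. *)
Lemma proj_eq D x p :
  D p -> (forall q, D q -> dotprod (x - p) (q - p) <= 0) -> Defs.proj D x = p.
Proof.
move=> Dp obt.
have pyth q : dotprod (x - q) (x - q) = dotprod (x - p) (x - p)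
    + dotprod (q - p) (q - p) - 2 * dotprod (x - p) (q - p).
  have -> : x - q = (x - p) - (q - p) by rewrite opprB addrA subrK.
  move: (x - p) (q - p) => e d.
  by rewrite !dotprodE (dotprodC d e); ring.
have np : nearest_point D x p.
  split => // q Dq; rewrite enorm_le (pyth q).
  by have := obt q Dq; have := dotprod_ge0 (q - p); lra.
have [Dr minr] : nearest_point D x (Defs.proj D x)
  by apply: (xgetPex 0 (P := [set p | nearest_point D x p])); exists p.
apply/eqP; rewrite -subr_eq0; apply/eqP/dotprod_eq0.
have := minr p Dp; rewrite enorm_le (pyth (Defs.proj D x)).
by have := obt _ Dr; lra.
Qed.

(** An intersection of closed half-spaces. This is what makes a self-dual cone closed, so that
    projecting onto it is possible. *)
Lemma closed_dual_cone K : closed (dual_cone K).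
Proof.
rewrite (_ : dual_cone K = \bigcap_(x in K) (dotprod x @^-1` [set r | 0 <= r])).
  apply: closed_bigI => x _; apply: preimage_closed => [y _|]; last exact: closed_ge.
  apply: (@continuous_dotprod (fun=> x) id) => z;
    [exact: cst_continuous | exact: cvg_id].
by apply/seteqP; split.
Qed.

Lemma convex_cone_convex K : convex_cone K ->
  convex_set (K : set (convex_lmodType 'rV[R]_m)).
Proof.
move=> [_ KD KZ] x y t /set_mem Kx /set_mem Ky; apply/mem_set.
by apply: KD; apply: KZ => //; rewrite unstable.onem_ge0.
Qed.

(** Here [p] is the nearest point of [K] to [z], and [n = p - z]. *)
Lemma moreau_decomposition K z : self_dual_cone K ->
  exists p n, [/\ K p, K n, z = p - n & dotprod p n = 0].
Proof.
move=> [cK Kd]; have [K0 KD KZ] := cK.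
have clK : closed K by rewrite Kd; exact: closed_dual_cone.
have [p np] := nearest_point_exists z K0 clK.
have Kp := np.1.
have obt k : K k -> dotprod (z - p) (k - p) <= 0.
  exact: nearest_point_obtuse (convex_cone_convex cK) np.
(* The angle condition at [0] and at [p + p], both in [K], bounds the product from below and from
   above. *)
have pn0 : dotprod (z - p) p = 0.
  have := obt _ (KZ 0 p (lexx 0) Kp); have := obt _ (KD p p Kp Kp).
  rewrite scale0r sub0r addrK dotprodNr; lra.
exists p, (p - z); split => //.
(* Since [z - p] is orthogonal to [p], the angle condition at [k] reduces to [<z - p, k> <= 0],
   which puts [p - z] in the dual cone. *)
- rewrite Kd => k Kk; have := obt k Kk.
  by rewrite dotprodDr dotprodNr pn0 subr0 -opprB dotprodNl dotprodC; lra.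
- by rewrite subKr.
- by rewrite dotprodC -opprB dotprodNl pn0 oppr0.
Qed.

Lemma self_dual_ge0 K x y : self_dual_cone K -> K x -> K y -> 0 <= dotprod x y.
Proof. by move=> [_ Kd] Kx; rewrite Kd; apply. Qed.

(** At a point [u - k] the angle product is [<n, p - k> = - <n, k>], nonpositive by self-duality.
    For the join, [- n] is paired with [k - p], with the same value. *)
Lemma gmeetE K u p n : self_dual_cone K -> K p -> K n -> dotprod p n = 0 ->
  gmeet K u (u - p + n) = u - p.
Proof.
move=> sK Kp Kn pn; apply: proj_eq => [|_ [k Kk <-]]; first by exists p.
rewrite [u - p + n]addrC addrK [u - k + _]addrC opprB subrKA.
by rewrite dotprodDr dotprodNr (dotprodC n p) pn add0r oppr_le0
  (self_dual_ge0 sK).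
Qed.

Lemma gjoinE K u p n : self_dual_cone K -> K p -> K n -> dotprod p n = 0 ->
  gjoin K u (u + p - n) = u + p.
Proof.
move=> sK Kp Kn pn; apply: proj_eq => [|_ [k Kk <-]]; first by exists p.
rewrite [u + p - n]addrC addrK [u + k]addrC addrKA.
by rewrite dotprodDr !dotprodNl dotprodNr (dotprodC n p) pn !oppr0 addr0 oppr_le0
  (self_dual_ge0 sK).
Qed.

End NearestPoints.

Theorem theorem2 (R : realType) (m : nat) (K C : set 'rV[R]_m) :
  self_dual_cone K ->
  C !=set0 ->
  closed C ->
  convex_set (C : set (convex_lmodType 'rV[R]_m)) ->
  lattice_invariant K C ->
  isotone_projection_set K C.
Proof.
move=> sK C0 clC cC invC x y xy; rewrite /cone_le.
have nu := proj_nearest x C0 clC; have nv := proj_nearest y C0 clC.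
move: (Defs.proj C x) (Defs.proj C y) nu nv => u v nu nv.
have [p [n [Kp Kn upn pn]]] := moreau_decomposition (u - v) sK.
have uE : u = v + p - n by rewrite -addrA -upn addrC subrK.
have vE : v = u - p + n by rewrite uE addrAC subrK addrK.
have Cmeet : C (u - p).
  by rewrite -(gmeetE u sK Kp Kn pn) -vE; exact: (invC u v nu.1 nv.1).1.
(* The join is based at [v] and the meet at [u]: the projected point must be the base shifted by
   [p - n] for the join and by [n - p] for the meet. *)
have Cjoin : C (v + p).
  by rewrite -(gjoinE v sK Kp Kn pn) -uE; exact: (invC v u nv.1 nu.1).2.
have := nearest_point_obtuse cC nu Cmeet.
have := nearest_point_obtuse cC nv Cjoin.
have := self_dual_ge0 sK xy Kp.
suff pp_le0 : dotprod p p <= 0 -> K (v - u).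
  move=> h1 h2 h3; apply: pp_le0; move: h1 h2 h3.
  have := congr1 (dotprod^~ p) upn.
  rewrite [u - p]addrC [v + p]addrC !addrK !dotprodE (dotprodC n p) pn; lra.
move=> /dotprod_eq0 p0.
by rewrite vE p0 subr0 addrC addKr.
Qed.
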